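(* For $x\in\mathbb{R}$ let $f(x)=x-\lfloor x\rfloor$. The set $S=\{x\in\mathbb{Z} : f(x\sqrt{2})\notin(0.4,\,1-0.4)\}\subseteq\mathbb{R}$ is not rational MICP-R.
   Context: $\mathbb{N}=\{1,2,\dots\}$, $\mathbb{Z}_+=\{0,1,2,\dots\}$; $n\in\mathbb{N}$, $p,d\in\mathbb{Z}_+$. A closed convex set $M\subseteq\mathbb{R}^{n+p+d}$ (with $d$) induces an MICP formulation of $S\subseteq\mathbb{R}^n$ if for every $x\in\mathbb{R}^n$: $x\in S$ iff there exist $y\in\mathbb{R}^p$, $z\in\mathbb{Z}^d$ with $(x,y,z)\in M$. The index set of the formulation is $I=\operatorname{proj}_z(M)\subseteq\mathbb{R}^d$, the projection of $M$ onto the last $d$ coordinates. For a convex (not necessarily closed) set $C\subseteq\mathbb{R}^d$, its recession cone is $C_\infty=\{r\in\mathbb{R}^d : x+\lambda r\in C\ \ \forall x\in C,\ \lambda\ge 0\}$. A convex set $I\subseteq\mathbb{R}^d$ is rationally unbounded if for every image $I'\subseteq\mathbb{R}^{d'}$ of $I$ under a rational affine map (a map $z\mapsto Az+b$ with $A,b$ having rational entries), either $I'$ is bounded or $\mathbb{Z}^{d'}\cap(I'_\infty\setminus\{0\})\neq\emptyset$. The set $S$ is rational MICP-R if it has an MICP formulation induced by some closed convex $M$ whose index set is rationally unbounded. *)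

(* Defs.v *)
From mathcomp Require Import all_boot all_order all_algebra.
From mathcomp Require Import all_classical all_reals all_analysis.

Set Implicit Arguments.
Unset Strict Implicit.
Unset Printing Implicit Defensive.

Import Order.TTheory GRing.Theory Num.Theory.
Import numFieldNormedType.Exports.

Local Open Scope classical_set_scope.
Local Open Scope ring_scope.

Section MICP.
Variable R : realType.

Definition recession_cone (d : nat) (C : set 'cV[R]_d) : set 'cV[R]_d :=
  [set r | forall x : 'cV[R]_d, C x -> forall l : R, 0 <= l -> C (x + l *: r)].

Definition rational_affine (d d' : nat) (A : 'M[rat]_(d', d)) (b : 'cV[rat]_d')
  (z : 'cV[R]_d) : 'cV[R]_d' := map_mx ratr A *m z + map_mx ratr b.

Definition rationally_unbounded (d : nat) (I : set 'cV[R]_d) : Prop :=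
  forall (d' : nat) (A : 'M[rat]_(d', d)) (b : 'cV[rat]_d'),
    let I' := rational_affine A b @` I in
    bounded_set I' \/
    exists r : 'cV[R]_d',
      [/\ r \is a mxOver Num.int, recession_cone I' r & r != 0].

Definition induces_MICP (n p d : nat) (M : set 'cV[R]_(n + p + d))
    (S : set 'cV[R]_n) : Prop :=
  [/\ closed M, convex_set M &
    forall x : 'cV[R]_n, S x <->
      exists (y : 'cV[R]_p) (z : 'cV[R]_d),
        z \is a mxOver Num.int /\ M (col_mx (col_mx x y) z)].

Definition index_set (n p d : nat) (M : set 'cV[R]_(n + p + d)) :
  set 'cV[R]_d := dsubmx @` M.

Definition rational_MICP_R (n : nat) (S : set 'cV[R]_n) : Prop :=
  exists (p d : nat) (M : set 'cV[R]_(n + p + d)),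
    induces_MICP M S /\ rationally_unbounded (index_set M).

Definition frac_part (x : R) : R := x - (Num.floor x)%:~R.

End MICP.

(* Main.v *)
Require Import Defs.
From mathcomp Require Import all_boot all_order all_algebra.
From mathcomp Require Import all_classical all_reals all_analysis.
From mathcomp Require Import zify ring lra.
Import Order.TTheory GRing.Theory Num.Theory.
Import numFieldNormedType.Exports.
Local Open Scope classical_set_scope.
Local Open Scope ring_scope.

(** Two facts about the set [S] of integers [x] with [x * sqrt 2] at distance
    at most 4/10 from the nearest integer contradict each other once a rational
    MICP formulation of [S] is given.

    On the arithmetic side, [S] is infinite, because [x] or [2 * x] lies in [S]
    for every integer [x], and yet [S] contains no nonconstant infinite
    arithmetic progression ([sqrt2_set_AP_free]): along a progression of step
    [e] the points [x * sqrt 2] are rotated modulo 1 by the irrational angle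
    [e * sqrt 2], some multiple of which is a nonzero rotation by less than
    1/5, and such small steps cannot jump over the forbidden gap, whose length
    is 1/5.

    On the convex side, a set of integers without nonconstant infinite
    arithmetic progressions that has a rational MICP formulation is finite
    ([rational_MICP_AP_free_finite]).  Over an integral point [z] of the index
    set the fiber in [x] is a convex set of integers, hence one point [phi z],
    so [phi] is a function on the integral indices.  If [r] is an integral
    recession direction of the index set, then [phi (z + k * r)] satisfies the
    midpoint rule in [k], so it is an arithmetic progression in [S], so it is
    constant: [phi] does not see the direction [r], which can be projected out.
    The same reasoning must then work for the projected index set, whose
    recession directions need not lift to the original one.  What survives
    every projection is the notion [faithful_projection]: integral indices can
    be chosen above every relevant integral point of the image, and [phi]
    factors through the projection, even on the convex hull of its graph.
    Rational unboundedness provides, for each projection, either an integral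
    recession direction, which is removed ([quotient_faithful]) and lowers the
    dimension, or boundedness, in which case the image has finitely many
    integral points and [phi] has finitely many values
    ([bounded_projection_finite]). *)

Definition AP_free {R : realType} (S : set R) : Prop :=
  forall x e : R, (forall k : nat, S (x + k%:R * e)) -> e = 0.

(** * Rotations by an irrational angle *)

Section Rotation.
Set Implicit Arguments.
Unset Strict Implicit.
Variable R : realType.
Implicit Types (x y a e th : R).

(** The union of the integer translates of the forbidden interval; unlike the
    fractional part, it is visibly symmetric under [y |-> - y]. *)
Definition in_gap y : Prop :=
  exists m : int, m%:~R + 4 / 10 < y < m%:~R + 6 / 10.

Lemma frac_part_gap y :
  (frac_part y \notin `]4 / 10, 1 - 4 / 10[ ) <-> ~ in_gap y.
Proof.
rewrite in_itv /= /frac_part; split.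
  move=> /negP yN [m /andP[m1 m2]]; apply: yN.
  have -> : Num.floor y = m.
    by apply: floor_def; rewrite intrD; apply/andP; split; lra.
  by apply/andP; split; lra.
move=> yN; apply/negP => /andP[y1 y2]; apply: yN.
by exists (Num.floor y); apply/andP; split; lra.
Qed.

Lemma in_gapN y : in_gap (- y) -> in_gap y.
Proof.
move=> [m /andP[m1 m2]]; exists (- m - 1).
by rewrite intrB intrN; apply/andP; split; lra.
Qed.

(** The gap has length 1/5, so steps shorter than that cannot jump over it:
    the first point past its left end still lies in it. *)
Lemma small_rotation_hits_gap_pos a e : 0 < e -> e < 1 / 5 ->
  exists j : nat, in_gap (a + j%:R * e).
Proof.
move=> e0 e5; set T := Num.floor a + 1.
have aT : a < T%:~R by exact: floorD1_gt.
have q0 : 0 <= (T%:~R + 4 / 10 - a) / e by apply: divr_ge0; lra.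
have := truncn_itv q0; set j := Num.truncn _ => /andP[j1 j2].
(* [j.+1] is the first step past the left end [T + 4 / 10] of the gap above
   [a]. *)
exists j.+1, T.
move: j1 j2; rewrite ler_pdivlMr // ltr_pdivrMr // -[j.+1%:R]natr1 => j1 j2.
by apply/andP; split; nra.
Qed.

Lemma small_rotation_hits_gap a e : e != 0 -> `|e| < 1 / 5 ->
  exists j : nat, in_gap (a + j%:R * e).
Proof.
have [e0 _|e0 _|//] := ltrgt0P e => e5.
  exact: small_rotation_hits_gap_pos.
have [|//|j gj] := @small_rotation_hits_gap_pos (- a) (- e).
  by rewrite oppr_gt0.
by exists j; apply: in_gapN; rewrite opprD -mulrN.
Qed.

(** Dirichlet's pigeonhole argument: two of the six multiples [0, ..., 5 * th]
    have fractional parts in the same fifth of the unit interval. *)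
Lemma irrational_small_multiple th :
  (forall (k : nat) (m : int), k%:R * th = m%:~R -> k = 0%N) ->
  exists (k : nat) (m : int),
    k%:R * th - m%:~R != 0 /\ `|k%:R * th - m%:~R| < 1 / 5.
Proof.
move=> irr.
pose fr (k : nat) := k%:R * th - (Num.floor (k%:R * th))%:~R.
have fr0 k : 0 <= fr k by rewrite subr_ge0 floor_le.
have fr1 k : fr k < 1 by rewrite ltrBlDl -intrD1 floorD1_gt.
pose bin (i : 'I_6) : 'I_5 := inord (Num.truncn (5 * fr i)).
have binE i : (bin i)%:R <= 5 * fr i < (bin i)%:R + 1.
  have h0 : 0 <= 5 * fr i by rewrite mulr_ge0.
  have /andP[h1 h2] := truncn_itv h0.
  have lt5 : (Num.truncn (5 * fr i) < 5)%N.
    rewrite -(ltr_nat R); apply: (le_lt_trans h1).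
    by have := fr1 i; lra.
  by rewrite /bin inordK // natr1 h1 h2.
have [i [j [ij bij]]] : exists i j : 'I_6, (i < j)%N /\ bin i = bin j.
  have /injectivePn [i [j nij eij]] : ~~ injectiveb bin.
    by apply/negP => /injectiveP /leq_card; rewrite !card_ord.
  have [?|?|/val_inj eq] := ltngtP i j; [by exists i, j|by exists j, i|].
  by rewrite eq eqxx in nij.
exists (j - i)%N, (Num.floor (j%:R * th) - Num.floor (i%:R * th)).
have E : (j - i)%:R * th - (Num.floor (j%:R * th) - Num.floor (i%:R * th))%:~R
    = fr j - fr i.
  by rewrite /fr natrB 1?ltnW // intrB; ring.
rewrite E; split.
  apply/negP; rewrite -E subr_eq0 => /eqP /irr /eqP.
  by rewrite subn_eq0 leqNgt ij.
have := binE i; have := binE j; rewrite bij => /andP[? ?] /andP[? ?].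
by rewrite ltr_norml; apply/andP; split; lra.
Qed.

(** In [2 * a ^ 2 = b ^ 2] the exponent of 2 is odd on the left and even on the
    right. *)
Lemma sqrt2_irrational (a b : int) : a%:~R * Num.sqrt 2 = b%:~R :> R -> a = 0.
Proof.
move=> E.
have E2 : (2 * `|a| ^ 2 = `|b| ^ 2)%N.
  have : (a * a * 2)%:~R = (b * b)%:~R :> R.
    by rewrite !intrM -E mulrACA -[Num.sqrt 2 * _]expr2 sqr_sqrtr.
  move=> /intr_inj /(congr1 absz); rewrite !abszM -!mulnn => <-.
  by rewrite mulnC.
apply/eqP; rewrite -absz_eq0; apply/negPn/negP; rewrite -lt0n => a0.
have b0 : (0 < `|b|)%N.
  by have := expn_gt0 `|b| 2; rewrite orbF -E2 muln_gt0 expn_gt0 a0 => <-.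
have := congr1 (logn 2) E2.
rewrite lognM ?expn_gt0 ?a0 // !lognX (logn_prime 2) //= => /(congr1 odd).
by rewrite oddD !oddM.
Qed.

Definition sqrt2_set : set R :=
  [set x | x \is a Num.int /\
      frac_part (x * Num.sqrt 2) \notin `]4 / 10, 1 - 4 / 10[ ].

Lemma sqrt2_set_AP_free : AP_free sqrt2_set.
Proof.
move=> x e Sx; apply/eqP/negPn/negP => e0.
have eint : e \is a Num.int.
  have [[x0 _] [x1 _]] := (Sx 0%N, Sx 1%N).
  have -> : e = (x + 1%:R * e) - (x + 0%:R * e) by ring.
  exact: rpredB.
have /intrP [c ce] := eint.
have [|k [m [km0 km5]]] := @irrational_small_multiple (e * Num.sqrt 2).
  move=> k m; rewrite ce mulrA -[k%:R]/((Posz k)%:~R) -intrM.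
  move=> /sqrt2_irrational /eqP; rewrite mulf_eq0 => /orP[/eqP[]//|/eqP c0].
  by rewrite ce c0 eqxx in e0.
have [j [T /andP[T1 T2]]] := small_rotation_hits_gap (x * Num.sqrt 2) km0 km5.
have [_ /frac_part_gap] := Sx (j * k)%N; apply.
exists (T + j%:Z * m); rewrite intrD intrM natrM.
by apply/andP; split; lra.
Qed.

(** Doubling sends a point of the gap (4/10, 6/10) into (8/10, 12/10), within
    1/5 of an integer, so one of [n] and [2 * n] always belongs to the set. *)
Lemma sqrt2_set_infinite : infinite_set sqrt2_set.
Proof.
have S12 (n : nat) : sqrt2_set n%:R \/ sqrt2_set (2 * n)%:R.
  have [[m /andP[m1 m2]]|nN] := pselect (in_gap (n%:R * Num.sqrt 2)); last first.
    by left; split; [exact: natr_int|exact/frac_part_gap].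
  right; split; first exact: natr_int.
  apply/frac_part_gap => -[T]; rewrite natrM -mulrA => /andP[T1 T2].
  have lo : T%:~R < (2 * m + 1)%:~R :> R by rewrite intrD intrM; lra.
  have hi : (2 * m + 1)%:~R < (T + 1)%:~R :> R by rewrite !intrD intrM; lra.
  by move: lo hi; rewrite !ltr_int ltzD1 => lo /(lt_le_trans lo); rewrite ltxx.
move=> Sfin; apply: infinite_nat.
pose f (n : nat) : R := n%:R; pose g (n : nat) : R := (2 * n)%:R.
have f_inj : injective f by move=> i j /eqP; rewrite eqr_nat => /eqP.
have g_inj : injective g.
  by move=> i j /eqP; rewrite eqr_nat eqn_pmul2l // => /eqP.
apply: (@sub_finite_set _ _ (f @^-1` sqrt2_set `|` g @^-1` sqrt2_set)).
  by move=> n _; exact: S12.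
rewrite finite_setU; split; apply: finite_preimage => //; exact: in2W.
Qed.

End Rotation.

(** * Projections of the index set *)

(** The convex hull of the relation [P] in [R * V], generated by segments
    rather than by finite convex combinations so that statements about the hull
    follow by induction. *)
Inductive segment_hull {R : realType} {V : lmodType R} (P : R -> V -> Prop) :
    R -> V -> Prop :=
| hull_base x z : P x z -> segment_hull P x z
| hull_segment x y z w t : 0 <= t <= 1 ->
    segment_hull P x z -> segment_hull P y w ->
    segment_hull P (t * x + (1 - t) * y) (t *: z + (1 - t) *: w).

Arguments hull_base {R V P x z}.
Arguments hull_segment {R V P x y z w t}.

Lemma entry_le_norm (R : realType) (m n : nat) (A : 'M[R]_(m, n)) i j :
  `|A i j| <= `|A|.
Proof.
rewrite [leRHS]mx_normrE.
exact: (le_bigmax _ (fun ij : 'I_m * 'I_n => `|A ij.1 ij.2|) (i, j)).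
Qed.

Lemma integral_shift (R : realType) (n m : nat) (z u : 'cV[R]_n) :
  z \is a mxOver Num.int -> u \is a mxOver Num.int ->
  z + m%:R *: u \is a mxOver Num.int.
Proof.
move=> /mxOverP zint /mxOverP uint; apply/mxOverP => i j; rewrite !mxE.
by rewrite rpredD // rpredM // natr_int.
Qed.

(** Here [P x z] stands for membership of [(x, z)] in the projection of the
    convex set of the formulation that forgets the continuous auxiliary
    variables. *)

Section Projections.
Set Implicit Arguments.
Unset Strict Implicit.
Variables (R : realType) (d : nat) (P : R -> 'cV[R]_d -> Prop) (S : set R).
Implicit Types (x y : R) (z w u : 'cV[R]_d).

Local Notation integral v := (v \is a mxOver Num.int).

Hypothesis P_convex : forall x y z w t, 0 <= t <= 1 -> P x z -> P y w ->
  P (t * x + (1 - t) * y) (t *: z + (1 - t) *: w).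
Hypothesis P_sound : forall x z, integral z -> P x z -> S x.
Hypothesis P_complete : forall x, S x -> exists2 z, integral z & P x z.
Hypothesis S_int : forall x, S x -> x \is a Num.int.
Hypothesis S_AP_free : AP_free S.

Definition indices : set 'cV[R]_d := [set z | exists x, P x z].

(** The graph of the function [phi] that sends an integral index to the only
    point of its fiber. *)
Definition lattice_graph x z : Prop := integral z /\ P x z.

Local Notation hull := (segment_hull lattice_graph).

Lemma hull_sub x z : hull x z -> P x z.
Proof. by elim=> [? ? []|*] //; exact: P_convex. Qed.

(** The fiber is convex and consists of integers; between two distinct ones
    there would be the half-integer [x + 1 / 2]. *)
Lemma fiber_unique x y z : integral z -> P x z -> P y z -> x = y.
Proof.
move=> zint; wlog xy : x y / x < y => [wlg|] Px Py.
  have [xy|yx|//] := ltgtP x y; [exact: wlg|exact/esym/wlg].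
have xint : x \is a Num.int by exact/S_int/(P_sound zint).
have yint : y \is a Num.int by exact/S_int/(P_sound zint).
have /intrP [m xm] := xint; have /intrP [n yn] := yint.
have mn : m%:~R + 1 <= n%:~R :> R.
  by rewrite -[1]/(1%:~R) -intrD ler_int lezD1 -(ltr_int R) -xm -yn.
pose t : R := 1 / (2 * (y - x)).
have yx0 : 0 < 2 * (y - x) by lra.
have t01 : 0 <= t <= 1.
  rewrite /t; apply/andP; split; first by apply: divr_ge0; lra.
  by rewrite ler_pdivrMr // mul1r; lra.
have := P_convex t01 Py Px; rewrite -scalerDl.
have -> : t + (1 - t) = 1 by ring.
rewrite scale1r => /(P_sound zint) /S_int /intrP [k].
have -> : t * y + (1 - t) * x = m%:~R + 1 / 2.
  by rewrite -xm /t; field; lra.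
move=> kE.
have lo : (m%:~R : R) < k%:~R by lra.
have hi : k%:~R < (m + 1)%:~R :> R by rewrite intrD; lra.
by move: lo hi; rewrite !ltr_int ltzD1 => lo /(lt_le_trans lo); rewrite ltxx.
Qed.

(** The invariant of the induction on the dimension of the projected index set.
    [proj_onto] makes the image of the lattice commensurable with the target
    lattice; it replaces the choice of unimodular coordinates, for which the
    projection would map the lattice onto the target lattice.  [proj_lift]
    supplies integral indices above the image of the real index set, and
    [proj_value] says that [phi] factors through the projection.  The latter is
    needed on the convex hull of the graph of [phi]: recession directions of
    the projected index set act on that hull, but in general not on [P]. *)
Record faithful_projection d' (A : 'M[R]_(d', d)) : Prop := {
  proj_integral : A \is a mxOver Num.int;
  proj_onto : forall w : 'cV[R]_d', integral w ->
    exists N u, [/\ N \is a Num.int, N != 0, integral u & A *m u = N *: w];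
  proj_lift : forall z u, indices z -> integral u -> A *m z = A *m u ->
    exists x v, lattice_graph x v /\ A *m v = A *m u;
  proj_value : forall x y z w, hull x z -> lattice_graph y w ->
    A *m z = A *m w -> x = y }.

Lemma identity_faithful : faithful_projection 1%:M.
Proof.
split.
- by apply: mxOver_scalar; [exact: rpred0|exact: rpred1].
- move=> w wint; exists 1, w; split; rewrite ?oner_eq0 ?rpred1 //.
  by rewrite mul1mx scale1r.
- move=> z u [x Px] uint; rewrite !mul1mx => zu.
  by exists x, u; rewrite mul1mx; split=> //; split=> //; rewrite -zu.
- move=> x y z w /hull_sub Px [wint Py]; rewrite !mul1mx => zw.
  by rewrite zw in Px; exact: (fiber_unique wint).
Qed.

Lemma AP_affine (X : nat -> R) :
  (forall k, X k.+1 = (X k + X k.+2) / 2) ->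
  forall k, X k = X 0%N + k%:R * (X 1%N - X 0%N).
Proof.
move=> mid k.
suff [] : X k = X 0%N + k%:R * (X 1%N - X 0%N) /\
          X k.+1 = X 0%N + k.+1%:R * (X 1%N - X 0%N) by [].
elim: k => [|k [IH1 IH2]]; first by split; ring.
by split=> //; move: IH2 (mid k); rewrite -[k.+2%:R]natr1 -[k.+1%:R]natr1; lra.
Qed.

Section Step.
Variables (d' : nat) (A : 'M[R]_(d', d)).
Hypothesis A_faithful : faithful_projection A.

(** A bounded set has finitely many integral points, and [phi] factors through
    them. *)
Lemma bounded_projection_finite :
  bounded_set ((fun z => A *m z) @` indices) -> finite_set S.
Proof.
rewrite /bounded_near => -[K0 [_ /(_ (K0 + 1))]]; set K := K0 + 1.
rewrite ltrDl ltr01 => /(_ isT) AK.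
have AleK z i : indices z -> `|(A *m z) i ord0| <= K.
  move=> Iz; apply: le_trans (AK (A *m z) _); last by exists z.
  exact: entry_le_norm.
pose N := Num.truncn K.
pose T := {ffun 'I_d' -> 'I_(2 * N).+1}.
(* Integral vectors with entries in [-N, N] are encoded by functions into
   ['I_(2 * N).+1], shifting the entries by [N]. *)
pose code (f : T) : 'cV[R]_d' := \col_i ((f i)%:R - N%:R).
pose val (v : 'cV[R]_d') : R :=
  xget 0 [set x | exists2 z, lattice_graph x z & A *m z = v].
apply: (@sub_finite_set _ _ ((val \o code) @` [set: T])); last first.
  exact/finite_image/finite_finset.
move=> x Sx; have [z zint Px] := P_complete Sx.
have Azint : integral (A *m z) by apply: mxOverM => //; exact: proj_integral.
exists [ffun i => inord (Num.truncn ((A *m z) i ord0 + N%:R))] => //=.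
set v := code _.
have -> : v = A *m z.
  apply/colP => i; rewrite mxE ffunE.
  have /mxOverP /(_ i ord0) /intrP [m mE] := Azint.
  have Iz : indices z by exists x.
  have := AleK z i Iz; rewrite mE -intr_norm -abszE => mK.
  have mN : (`|m| <= N)%N by rewrite truncn_ge_nat // (le_trans _ mK).
  have [k kE] : exists k : nat, m + N%:Z = k%:Z by exists (absz (m + N%:Z)); lia.
  have -> : m%:~R + N%:R = k%:R :> R by rewrite -[N%:R]/(N%:Z%:~R) -intrD kE.
  rewrite natrK inordK; last by lia.
  by rewrite -[k%:R]/(k%:Z%:~R) -kE intrD addrK.
rewrite /val; case: xgetP => [y _ [w [wint Py] Aw]|/(_ x)[]]; last by exists z.
by apply: (proj_value A_faithful (hull_base (conj wint Py)) _ Aw).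
Qed.

Variable u : 'cV[R]_d.
Hypothesis u_integral : integral u.
Hypothesis u_recession : recession_cone ((fun z => A *m z) @` indices) (A *m u).

(** Where the absence of progressions is used: the points
    [A *m z + k%:R *: (A *m u)] lift to integral indices whose values satisfy
    the midpoint rule, hence form a progression in [S], hence are constant. *)
Lemma shift_lift x z (m : nat) : lattice_graph x z ->
  exists2 w, lattice_graph x w & A *m w = A *m z + m%:R *: (A *m u).
Proof.
move=> [zint Px].
have /choice [F HF] : forall k : nat, exists p : R * 'cV[R]_d,
    lattice_graph p.1 p.2 /\ A *m p.2 = A *m z + k%:R *: (A *m u).
  move=> k; have Az : ((fun z => A *m z) @` indices) (A *m z).
    by exists z => //; exists x.
  have [z' Iz' Ez'] := u_recession Az (ler0n R k).
  have E : A *m (z + k%:R *: u) = A *m z + k%:R *: (A *m u).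
    by rewrite mulmxDr -scalemxAr.
  have [||y [v [Gv Ev]]] := proj_lift A_faithful Iz' (u := z + k%:R *: u).
  - exact: integral_shift.
  - by rewrite E.
  - by exists (y, v); rewrite -E.
pose X k := (F k).1.
have mid k : X k.+1 = (X k + X k.+2) / 2.
  apply/esym; have [[[G1 E1] [G2 E2]] [G3 E3]] := (HF k, HF k.+1, HF k.+2).
  have half01 : 0 <= (2^-1 : R) <= 1 by apply/andP; split; lra.
  have := hull_segment half01 (hull_base G1) (hull_base G3).
  have -> : 2^-1 * X k + (1 - 2^-1) * X k.+2 = (X k + X k.+2) / 2 by field.
  move=> Hmid; apply: (proj_value A_faithful Hmid G2).
  rewrite mulmxDr -!scalemxAr E1 E2 E3 !scalerDr !scalerA addrACA -!scalerDl.
  rewrite (_ : 2^-1 + (1 - 2^-1) = 1) ?scale1r; last by ring.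
  by congr (_ + _ *: _); rewrite -![k.+2%:R]natr1 -![k.+1%:R]natr1; field.
have Xaff := AP_affine mid.
have X10 : X 1%N - X 0%N = 0.
  apply: (@S_AP_free (X 0%N)) => k; rewrite -Xaff.
  by have [[? Pk] _] := HF k; exact: P_sound Pk.
have [G0 E0] := HF 0%N.
have xX0 : x = X 0%N.
  apply: (proj_value A_faithful (hull_base (conj zint Px)) G0).
  by rewrite E0 scale0r addr0.
have [Gm Em] := HF m; exists (F m).2 => //.
by rewrite xX0; have := Xaff m; rewrite X10 mulr0 addr0 => <-.
Qed.

(** The previous lemma passes to convex combinations for integral multiples of
    the direction, and then to real multiples by interpolating between two
    consecutive integral ones. *)
Lemma shift_hull x z t : hull x z -> 0 <= t ->
  exists2 w, hull x w & A *m w = A *m z + t *: (A *m u).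
Proof.
have shift_nat y w (m : nat) : hull y w ->
    exists2 w', hull y w' & A *m w' = A *m w + m%:R *: (A *m u).
  elim=> [{}y {}w Gw|{}y y' {}w w' s s01 _ [v Hv Ev] _ [v' Hv' Ev']].
    by have [v Gv Ev] := shift_lift m Gw; exists v => //; exact: hull_base.
  exists (s *: v + (1 - s) *: v'); first exact: hull_segment.
  rewrite !mulmxDr -!scalemxAr Ev Ev' !scalerDr addrACA -scalerDl.
  by rewrite (_ : s + (1 - s) = 1) ?scale1r //; ring.
move=> Hz t0; have /andP[m1 m2] := truncn_itv t0; move: m1 m2.
set m := Num.truncn t => m1; rewrite -natr1 => m2.
have [v Hv Ev] := shift_nat _ _ m Hz.
have [v' Hv' Ev'] := shift_nat _ _ m.+1 Hz.
pose s : R := m%:R + 1 - t.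
exists (s *: v + (1 - s) *: v').
  rewrite (_ : x = s * x + (1 - s) * x); last by ring.
  by apply: hull_segment => //; rewrite /s; apply/andP; split; lra.
rewrite !mulmxDr -!scalemxAr Ev Ev' !scalerDr addrACA !scalerA -!scalerDl.
rewrite (_ : s + (1 - s) = 1) ?scale1r; last by ring.
by congr (_ + _ *: _); rewrite /s -natr1; ring.
Qed.

(** If two points have the same image under [B *m A], their images under [A]
    differ by a real multiple [c] of the direction [A *m u].  Moving both by a
    large multiple [N] of the direction makes [c + N] nonnegative, so that the
    recession hypothesis applies, and keeps integral points integral. *)
Lemma quotient_faithful d'' (B : 'M[R]_(d'', d')) :
  integral B ->
  (forall w : 'cV[R]_d'', integral w ->
    exists N v, [/\ N \is a Num.int, N != 0, integral v & B *m v = N *: w]) ->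
  (forall v, B *m v = 0 -> exists c, v = c *: (A *m u)) ->
  B *m (A *m u) = 0 ->
  faithful_projection (B *m A).
Proof.
move=> Bint Bonto Bker Bu.
have kerP z w : B *m A *m z = B *m A *m w ->
    exists c (N : nat), 0 <= c + N%:R /\ A *m w = A *m z + c *: (A *m u).
  rewrite -!mulmxA => E.
  have [|c Ec] := Bker (A *m w - A *m z).
    by rewrite mulmxBr E subrr.
  exists c, (Num.truncn (- c)).+1; split; last by rewrite -Ec addrC subrK.
  by have := @truncnS_gt _ (- c); lra.
split.
- by apply: mxOverM => //; exact: proj_integral.
- move=> w /Bonto [N [v [Nint N0 vint Ev]]].
  have [N' [u' [N'int N'0 u'int Eu']]] := proj_onto A_faithful vint.
  exists (N' * N), u'; split; rewrite ?mulf_neq0 ?rpredM //.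
  by rewrite -mulmxA Eu' -scalemxAr Ev scalerA.
- move=> z w Iz wint /kerP [c [N [cN E]]].
  have Az : ((fun z => A *m z) @` indices) (A *m z) by exists z.
  have [z' Iz' Ez'] := u_recession Az cN.
  have [||x [v [Gv Ev]]] := proj_lift A_faithful Iz' (u := w + N%:R *: u).
  + exact: integral_shift.
  + by rewrite Ez' mulmxDr -scalemxAr E scalerDl addrA.
  exists x, v; split=> //.
  by rewrite -!mulmxA Ev mulmxDr -scalemxAr mulmxDr -scalemxAr Bu scaler0 addr0.
- move=> x y z w Hz Gw /kerP [c [N [cN E]]].
  have [z' Hz' Ez'] := shift_hull Hz cN.
  have [w' Gw' Ew'] := shift_lift N Gw.
  apply: (proj_value A_faithful Hz' Gw').
  by rewrite Ez' Ew' E scalerDl addrA.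
Qed.

End Step.

(** With [r i != 0], the map [w |-> r i *: w - w i *: r] is integral, kills
    exactly the multiples of [r], and has zero [i]-th coordinate, which is
    dropped.  An integral section up to the factor [r i] inserts a zero there. *)
Lemma integral_quotient m (r : 'cV[R]_m.+1) : integral r -> r != 0 ->
  exists B : 'M[R]_(m, m.+1), [/\ integral B,
    forall w : 'cV[R]_m, integral w ->
      exists N v, [/\ N \is a Num.int, N != 0, integral v & B *m v = N *: w],
    forall v, B *m v = 0 -> exists c, v = c *: r & B *m r = 0].
Proof.
move=> /mxOverP rint r0.
have [i ri0] : exists i, r i ord0 != 0.
  apply/not_existsP => h; move/eqP: r0; apply; apply/colP => i; rewrite mxE.
  by apply/eqP/negPn/negP/h.
pose C : 'M[R]_m.+1 := r i ord0 *: 1%:M - r *m row i 1%:M.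
have CE (v : 'cV[R]_m.+1) : C *m v = r i ord0 *: v - v i ord0 *: r.
  rewrite mulmxBl -scalemxAl mul1mx -mulmxA -row_mul mul1mx; congr (_ - _).
  by rewrite [row i v]mx11_scalar mxE mul_mx_scalar.
have BE (v : 'cV[R]_m.+1) j : (row' i C *m v) j ord0 =
    r i ord0 * v (lift i j) ord0 - v i ord0 * r (lift i j) ord0.
  transitivity ((C *m v) (lift i j) ord0); last by rewrite CE !mxE.
  by rewrite row'Esub mul_rowsub_mx [LHS]mxE.
exists (row' i C); split.
- apply/mxOverP => j k; rewrite !mxE; apply: rpredB.
    by rewrite rpredM ?natr_int ?rint.
  by rewrite big_ord1 !mxE rpredM ?natr_int ?rint.
- move=> w /mxOverP wint; exists (r i ord0).
  exists (\col_k if unlift i k is Some j then w j ord0 else 0); split=> //.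
    by apply/mxOverP => k j; rewrite !mxE; case: unlift => [l|]; rewrite ?rpred0.
  by apply/colP => j; rewrite BE !mxE liftK unlift_none mul0r subr0.
- move=> v Bv; exists (v i ord0 / r i ord0); apply/colP => k; rewrite !mxE.
  have [j ->|->] := unliftP i k; last by rewrite divfK.
  have := BE v j; rewrite Bv mxE => /eqP; rewrite eq_sym subr_eq0 => /eqP E.
  by apply: (mulfI ri0); rewrite E; field.
- by apply/colP => j; rewrite BE mxE mulrC subrr.
Qed.

Lemma integral_affine d' (A : 'M[R]_(d', d)) : A \is a mxOver Num.int ->
  exists A0 : 'M[rat]_(d', d), forall z, rational_affine A0 0 z = A *m z.
Proof.
move=> /mxOverP Aint; exists (map_mx (fun a => (Num.floor a)%:~R) A) => z.
rewrite /rational_affine map_mx0 addr0; congr (_ *m z).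
by apply/matrixP => i j; rewrite !mxE ratr_int floorK.
Qed.

Lemma faithful_projection_finite d' (A : 'M[R]_(d', d)) :
  rationally_unbounded indices -> faithful_projection A -> finite_set S.
Proof.
move=> Iunb; elim: d' A => [|d' IH] A Afaith.
  have [A0 A0E] := integral_affine (proj_integral Afaith).
  have := Iunb _ A0 0; rewrite /= (funext A0E) => -[|[r [_ _ /negP[]]]].
    exact: bounded_projection_finite.
  exact/eqP/flatmx0.
have [A0 A0E] := integral_affine (proj_integral Afaith).
have := Iunb _ A0 0; rewrite /= (funext A0E) => -[|[r [rint rrec r0]]].
  exact: bounded_projection_finite.
have [N [v [Nint N0 vint Ev]]] := proj_onto Afaith rint.
(* [A *m v] is [N *: r] with [N] of unknown sign; multiplying by [N] once more
   gives a nonnegative multiple of [r], still a recession direction. *)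
pose u := N *: v.
have uint : integral u by apply: mxOverZ.
have Au : A *m u = (N * N) *: r by rewrite -scalemxAr Ev scalerA.
have NN0 : N * N != 0 by rewrite mulf_neq0.
have urec : recession_cone ((fun z => A *m z) @` indices) (A *m u).
  move=> w Iw l l0; rewrite Au scalerA; apply: rrec => //.
  by rewrite mulr_ge0 // -expr2 sqr_ge0.
have [B [Bint Bonto Bker Br]] := integral_quotient rint r0.
apply: (IH (B *m A)); apply: (quotient_faithful Afaith uint urec) => //.
  move=> w /Bker [c ->]; exists (c / (N * N)).
  by rewrite Au scalerA divfK.
by rewrite Au -scalemxAr Br scaler0.
Qed.

End Projections.

(** * Sets of integers with a rational formulation *)

Theorem rational_MICP_AP_free_finite {R : realType} (S : set R) :
  (forall x, S x -> x \is a Num.int) -> AP_free S ->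
  rational_MICP_R [set v : 'cV[R]_1 | S (v ord0 ord0)] -> finite_set S.
Proof.
move=> Sint Sap [p [d [M [[_ Mconv MS] Iunb]]]].
pose P (x : R) (z : 'cV[R]_d) :=
  exists y : 'cV[R]_p, M (col_mx (col_mx (const_mx x : 'cV_1) y) z).
have P_convex x y z w t : 0 <= t <= 1 -> P x z -> P y w ->
    P (t * x + (1 - t) * y) (t *: z + (1 - t) *: w).
  move=> /andP[t0 t1] [a Ma] [b Mb]; exists (t *: a + (1 - t) *: b).
  have := Mconv _ _ (Itv01 t0 t1) (mem_set Ma) (mem_set Mb).
  rewrite inE /conv /= !scale_col_mx !add_col_mx.
  rewrite (_ : t *: const_mx x + (1 - t) *: const_mx y =
               const_mx (t * x + (1 - t) * y)) //.
  by apply/colP => i; rewrite !mxE.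
have P_sound x z : z \is a mxOver Num.int -> P x z -> S x.
  move=> zint [y My]; have := (MS (const_mx x)).2.
  by rewrite /= mxE; apply; exists y, z.
have P_complete x : S x -> exists2 z, z \is a mxOver Num.int & P x z.
  move=> Sx; have := (MS (const_mx x)).1.
  by rewrite /= mxE => /(_ Sx) [y [z [zint Mz]]]; exists z => //; exists y.
have idP := identity_faithful P_convex P_sound Sint.
apply: (faithful_projection_finite P_sound P_complete Sap _ idP).
rewrite (_ : indices P = index_set M) //; apply/seteqP; split=> z.
  by move=> [x [y Mxyz]]; exists (col_mx (col_mx (const_mx x) y) z) => //;
    rewrite col_mxKd.
move=> [v Mv <-]; exists (usubmx (usubmx v) ord0 ord0), (dsubmx (usubmx v)).
suff -> : const_mx (usubmx (usubmx v) ord0 ord0) = usubmx (usubmx v).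
  by rewrite !vsubmxK.
by apply/colP => i; rewrite [LHS]mxE (ord1 i).
Qed.

Theorem corollary5p2 (R : realType) :
  let S : set R :=
    [set x | x \is a Num.int /\
      frac_part (x * Num.sqrt 2) \notin `]4 / 10, 1 - 4 / 10[ ] in
  ~ rational_MICP_R [set v : 'cV[R]_1 | S (v ord0 ord0)].
Proof.
move=> S Smicp; apply: (@sqrt2_set_infinite R).
apply: rational_MICP_AP_free_finite Smicp; first by move=> x [].
exact: sqrt2_set_AP_free.
Qed.
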